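(* Let $A\in\mathbb{R}^{n\times n}$ be passive, $B\in\mathbb{R}^{n\times q}$, $C\in\mathbb{R}^{p\times n}$, and let $V_k\in\mathbb{R}^{n\times d_k}$ have orthonormal columns. Put $T_k=V_k^*AV_k$, $B_k=V_k^*B$, $C_k=CV_k$, let $Y_k\ge 0$ be the stabilizing solution of $T_k^*Y+YT_k-YB_kB_k^*Y+C_k^*C_k=0$, and let $X_k=V_kY_kV_k^*$. Let $R_k=A^*X_k+X_kA-X_kBB^*X_k+C^*C$ and $\mathcal{T}_k=V_k^*(A-BB^*X_k)V_k=T_k-B_kB_k^*Y_k$. Assume that the columns of $C^*$ belong to $\mathrm{range}(V_k)$. Then $$R_k=\widehat R_kV_k^*+V_k\widehat R_k^*,\qquad\text{with}\quad \widehat R_k=A^*V_kY_k+V_kY_k\mathcal{T}_k+C^*(CV_k),$$ and consequently $\|R_k\|_F=\sqrt2\,\|\widehat R_k\|_F$.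
   Context: $M^*$ denotes the conjugate transpose and $\|\cdot\|_F$ the Frobenius norm. $Y\ge0$ means symmetric positive semidefinite. A matrix is stable if all its eigenvalues lie in the open left half complex plane; $A$ is passive if its field of values $\{x^*Ax/(x^*x): 0\ne x\in\mathbb{C}^n\}$ lies in the open left half plane. If $A$ is passive then $T_k$ is stable and the reduced Riccati equation has a unique positive semidefinite solution $Y_k$ that is stabilizing, i.e. such that $T_k-B_kB_k^*Y_k$ is stable. *)

(* Defs.v *)
From HB Require Import structures.
From mathcomp Require Import all_boot all_order all_algebra.
From mathcomp Require Import classical_sets reals.
From mathcomp Require Import complex.

Set Implicit Arguments.
Unset Strict Implicit.
Unset Printing Implicit Defensive.

Import Order.TTheory GRing.Theory Num.Theory.
Local Open Scope classical_set_scope.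
Local Open Scope ring_scope.
Local Open Scope sesquilinear_scope.

(* Only vectors and eigenvalues are ever genuinely complex.  The matrices are
   real, so their conjugate transpose M^* is written as the transpose M^T. *)

Definition complexify (R : realType) (m n : nat) (M : 'M[R]_(m, n)) :
    'M[R[i]]_(m, n) :=
  map_mx (real_complex R) M.

Definition open_left_half_plane (R : realType) : set R[i] :=
  [set z | complex.Re z < 0].

Definition field_of_values (R : realType) (n : nat) (A : 'M[R]_n) :
    set R[i] :=
  [set (x ^t* *m complexify A *m x) 0 0 / (x ^t* *m x) 0 0
     | x in [set x : 'cV[R[i]]_n | x != 0]].

Definition passive (R : realType) (n : nat) (A : 'M[R]_n) : Prop :=
  field_of_values A `<=` @open_left_half_plane R.

Definition stable (R : realType) (n : nat) (A : 'M[R]_n) : Prop :=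
  [set z | eigenvalue (complexify A) z] `<=` @open_left_half_plane R.

Definition psd (R : realType) (n : nat) (Y : 'M[R]_n) : Prop :=
  Y^T = Y /\ forall x : 'cV[R]_n, 0 <= (x^T *m Y *m x) 0 0.

Definition riccati (R : realType) (n q p : nat)
    (A : 'M[R]_n) (B : 'M[R]_(n, q)) (C : 'M[R]_(p, n)) (X : 'M[R]_n) :
    'M[R]_n :=
  A^T *m X + X *m A - X *m B *m B^T *m X + C^T *m C.

Definition stabilizing_solution (R : realType) (n q p : nat)
    (A : 'M[R]_n) (B : 'M[R]_(n, q)) (C : 'M[R]_(p, n)) (X : 'M[R]_n) : Prop :=
  [/\ psd X, riccati A B C X = 0 & stable (A - B *m B^T *m X)].

Definition column_range (R : realType) (m n : nat) (V : 'M[R]_(m, n)) :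
    set 'cV[R]_m :=
  range (fun w : 'cV[R]_n => V *m w).

Definition frobenius (R : realType) (m n : nat) (M : 'M[R]_(m, n)) : R :=
  Num.sqrt (\sum_(i < m) \sum_(j < n) `|M i j| ^+ 2).

(* Main.v *)
(* The reduced Riccati equation says exactly that V^T Rhat = 0.  Hence the two
   summands Rhat V^T and V Rhat^T are orthogonal for the Frobenius inner product
   and, V having orthonormal columns, both have the Frobenius norm of Rhat.
   The inclusion of range(C^T) in range(V) gives V V^T C^T = C^T, so the
   C^T C terms of both summands need no projection. *)

Require Import Defs.
From mathcomp Require Import all_boot all_order all_algebra.
From mathcomp Require Import classical_sets reals.
From mathcomp Require Import complex.
Import Order.TTheory GRing.Theory Num.Theory.
Local Open Scope ring_scope.

Lemma frobeniusE (R : realType) (m n : nat) (M : 'M[R]_(m, n)) :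
  frobenius M = Num.sqrt (\tr (M *m M^T)).
Proof.
rewrite /frobenius /mxtrace; congr Num.sqrt; apply: eq_bigr => i _.
rewrite mxE; apply: eq_bigr => j _.
by rewrite mxE real_normK ?num_real // expr2.
Qed.

(** By symmetry of [X], the two closed-loop terms each subtract [X *m B *m B^T *m X], whereas the
    Riccati equation subtracts it only once. One copy is therefore left over. *)
Lemma riccati_closed_loop (R : realType) (n q p : nat)
    (A : 'M[R]_n) (B : 'M[R]_(n, q)) (C : 'M[R]_(p, n)) (X : 'M[R]_n) :
  X^T = X -> riccati A B C X = 0 ->
  X *m (A - B *m B^T *m X) + (A - B *m B^T *m X)^T *m X =
  - (X *m B *m B^T *m X + C^T *m C).
Proof.
move=> Xsym ricX; apply/eqP; rewrite -subr_eq0 opprK -ricX /riccati; apply/eqP.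
rewrite [(A - _)^T]raddfB /= !trmx_mul trmxK Xsym mulmxBr mulmxBl !mulmxA.
set a := X *m A; set b := A^T *m X; set c := X *m _ *m _ *m _.
by rewrite !addrA subrK [a - c + b]addrAC [a + b]addrC.
Qed.

(** Each column of [M] is some [V *m w], and [V *m V^T] fixes it since [V^T *m V = 1%:M]. *)
Lemma orthogonal_projection_id (R : realType) (n d p : nat)
    (V : 'M[R]_(n, d)) (M : 'M[R]_(n, p)) :
  V^T *m V = 1%:M -> (forall j, column_range V (col j M)) ->
  V *m V^T *m M = M.
Proof.
move=> VV1 rangeM; apply/matrixP => i j.
have [w _ Vw] := rangeM j.
have colM : col j (V *m V^T *m M) = col j M.
  by rewrite !colE -mulmxA -colE -Vw -mulmxA [V^T *m _]mulmxA VV1 mul1mx Vw colE.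
by have /matrixP/(_ i 0) := colM; rewrite !mxE.
Qed.

Lemma frobenius_symmetrized (R : realType) (n d : nat) (V W : 'M[R]_(n, d)) :
  V^T *m V = 1%:M -> V^T *m W = 0 ->
  frobenius (W *m V^T + V *m W^T) = Num.sqrt 2 * frobenius W.
Proof.
move=> VV1 VW0.
have WV0 : W^T *m V = 0 by rewrite -[V]trmxK -trmx_mul VW0 trmx0.
rewrite !frobeniusE -sqrtrM ?ler0n //; congr Num.sqrt.
rewrite linearD /= !trmx_mul !trmxK mulmxDl !mulmxDr.
rewrite -!mulmxA ![V^T *m (_ *m _)]mulmxA ![W^T *m (V *m _)]mulmxA VV1 VW0 WV0.
rewrite !mul0mx !mulmx0 mul1mx addr0 add0r mxtraceD.
(* The cross terms are gone. Cyclicity of the trace brings [V^T] next to [V] in the remaining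
   projected term, which becomes a second copy of the trace of [W *m W^T]. *)
rewrite [\tr (V *m _)]mxtrace_mulC -!mulmxA VV1 mulmx1.
by rewrite [\tr (W^T *m _)]mxtrace_mulC mulr_natl mulr2n.
Qed.

Theorem proposition5p3 (R : realType) (n q p d : nat)
    (A : 'M[R]_n) (B : 'M[R]_(n, q)) (C : 'M[R]_(p, n)) (V : 'M[R]_(n, d))
    (Y : 'M[R]_d) :
  let T := V^T *m A *m V in
  let Bk := V^T *m B in
  let Ck := C *m V in
  let X := V *m Y *m V^T in
  let Rk := riccati A B C X in
  let cT := V^T *m (A - B *m B^T *m X) *m V in
  let Rhat := A^T *m V *m Y + V *m Y *m cT + C^T *m (C *m V) in
  passive A ->
  V^T *m V = 1%:M ->
  stabilizing_solution T Bk Ck Y ->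
  (forall j : 'I_p, column_range V (col j C^T)) ->
  [/\ cT = T - Bk *m Bk^T *m Y,
      Rk = Rhat *m V^T + V *m Rhat^T
    & frobenius Rk = Num.sqrt 2 * frobenius Rhat].
Proof.
move=> T Bk Ck X Rk cT Rhat _ VV1 [[Ysym _] ricY _] rangeC.
have cTE : cT = T - Bk *m Bk^T *m Y.
  rewrite /cT /T /Bk /X mulmxBr mulmxBl trmx_mul trmxK !mulmxA; congr (_ - _).
  by rewrite -[LHS]mulmxA VV1 mulmx1.
have XE : X = V *m Y *m V^T by [].
(* From here on [cT] and [X] are atoms for reassociation, unfolded only through [cTE] and [XE]. *)
clearbody cT X.
have projC : V *m V^T *m C^T = C^T by exact: orthogonal_projection_id.
have Cproj : C *m V *m V^T = C.
  by rewrite -[RHS]trmxK -projC !trmx_mul !trmxK mulmxA.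
(* The product collapses to [T^T *m Y + Y *m cT + Ck^T *m Ck]; expanding [cT] gives the reduced
   Riccati residual. *)
have VRhat0 : V^T *m Rhat = 0.
  rewrite -ricY /riccati /Rhat !mulmxDr !mulmxA VV1 mul1mx cTE mulmxBr.
  by rewrite /T /Ck !trmx_mul !trmxK !mulmxA !addrA.
have Xsym : X^T = X by rewrite XE !trmx_mul trmxK Ysym mulmxA.
have RhatVE : Rhat *m V^T = A^T *m X + V *m Y *m cT *m V^T + C^T *m C.
  by rewrite /Rhat !mulmxDl -!mulmxA [C *m _]mulmxA Cproj XE !mulmxA.
have VRhatE : V *m Rhat^T = X *m A + V *m cT^T *m Y *m V^T + C^T *m C.
  rewrite -[V]trmxK -trmx_mul trmxK RhatVE !linearD /= !trmx_mul !trmxK.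
  by rewrite Xsym Ysym !mulmxA.
have lyapunov : Y *m cT + cT^T *m Y = - (Y *m Bk *m Bk^T *m Y + Ck^T *m Ck).
  by rewrite cTE; exact: riccati_closed_loop.
have RkE : Rk = Rhat *m V^T + V *m Rhat^T.
  have CC : V *m (Ck^T *m Ck) *m V^T = C^T *m C.
    by rewrite /Ck trmx_mul !mulmxA projC -!mulmxA [C *m _]mulmxA Cproj.
  have XBX : V *m (Y *m Bk *m Bk^T *m Y) *m V^T = X *m B *m B^T *m X.
    by rewrite /Bk XE trmx_mul trmxK !mulmxA.
  (* The two summands together contain [C^T *m C] twice and no explicit quadratic term. Lifting
     [lyapunov] by [V] supplies that term and cancels the surplus [C^T *m C]. *)
  have VlyapV : V *m Y *m cT *m V^T + V *m cT^T *m Y *m V^T =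
      - (X *m B *m B^T *m X) - C^T *m C.
    rewrite -XBX -CC -[V *m Y *m cT]mulmxA -[V *m cT^T *m Y]mulmxA.
    by rewrite -mulmxDl -mulmxDr lyapunov mulmxN mulNmx mulmxDr mulmxDl opprD.
  rewrite RhatVE VRhatE [RHS]addrACA [Z in _ = Z + _]addrACA VlyapV.
  by rewrite !addrA subrK.
by split=> //; rewrite RkE frobenius_symmetrized.
Qed.
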